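(* Let $I$, $J$, $(\nu_{n,k})$, $(K_{n,k})$ and the operators $S_n$ be as in the context. Let $f:I\to\mathbb{R}$ be a bounded function. Then $$\lim_{n\to+\infty}(S_nf)(t)=f(t)$$ for every point $t\in I$ of continuity of $f$. Moreover, if $f$ is also uniformly continuous on $I$ and condition (4) of the context is satisfied uniformly with respect to $t\in I$ (that is, for every $\delta>0$, $\lim_{n\to+\infty}\sup_{t\in I}\sum_{k\in J,\,|\nu_{n,k}-t|\ge\delta}|K_{n,k}(t)|=0$), then $$\lim_{n\to+\infty}\|S_nf-f\|_\infty=0.$$
   Context: Let $I\subset\mathbb{R}$ be an interval (bounded or not). For each $n\in\mathbb{N}^+=\{1,2,3,\dots\}$ let $J\subset\mathbb{Z}$ be an at most countable index set ($J$ is allowed to depend on $n$) and let $(\nu_{n,k})_{k\in J}\subset I$ be a sequence of points such that $\lambda_n<\nu_{n,k+1}-\nu_{n,k}\le\Lambda_n$ for every $k\in J$ (with $k+1\in J$), where $\lambda_n,\Lambda_n>0$ and $\lim_{n\to+\infty}\lambda_n=\lim_{n\to+\infty}\Lambda_n=0$. Let $K_{n,k}:I\to\mathbb{R}$ ($n\in\mathbb{N}^+$, $k\in J$) be continuous functions such that: (1) $\sum_{k\in J}K_{n,k}(t)=1$ for every $n\in\mathbb{N}^+$ and $t\in I$; (2) for every $n\in\mathbb{N}^+$, the series $\sum_{k\in J}|K_{n,k}(t)|$ converges uniformly on compact subsets of $I$; (3) there exists $M_0$ such that $m_0(n):=\sup_{t\in I}\sum_{k\in J}|K_{n,k}(t)|<M_0$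 for every $n\in\mathbb{N}^+$; (4) $\lim_{n\to+\infty}\sum_{k\in J,\,|\nu_{n,k}-t|\ge\delta}|K_{n,k}(t)|=0$ for every $\delta>0$ and $t\in I$. For a bounded function $f:I\to\mathbb{R}$ and $n\in\mathbb{N}^+$, define $(S_nf)(t)=\sum_{k\in J}f(\nu_{n,k})K_{n,k}(t)$ for $t\in I$. For a bounded function $g:I\to\mathbb{R}$, $\|g\|_\infty:=\sup_{t\in I}|g(t)|$. *)

(* Defs.v *)
From HB Require Import structures.
From mathcomp Require Import all_boot all_order all_algebra finmap.
From mathcomp Require Import all_classical all_reals all_analysis.
From mathcomp.analysis.showcase Require summability.

Set Implicit Arguments.
Unset Strict Implicit.
Unset Printing Implicit Defensive.

Import Order.TTheory GRing.Theory Num.Theory.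
Import numFieldNormedType.Exports.

Local Open Scope classical_set_scope.
Local Open Scope ring_scope.

(** Functions on [I] are represented by total functions [R -> R] of which only
    the values on [I] are ever constrained or used; families indexed by
    [J n] are likewise total on [int]. *)

Section series.
Context {R : realType}.

(* [\sum_(k in J) a k] is the limit of the finite partial sums along the finite
   sets of integers directed by inclusion.  For absolutely convergent families
   this is the sum of the series for any enumeration of [J]. *)
Definition psum (J : set int) (a : int -> R) (A : {fset int}) : R :=
  \sum_(k <- A | k \in J) a k.

Definition sums_to (J : set int) (a : int -> R) (s : R) : Prop :=
  psum J a @ summability.totally --> s.

Definition sum_over (J : set int) (a : int -> R) : R :=
  lim (psum J a @ summability.totally).

(* For nonnegative terms, uniform convergence along finite subsets is the same
   as uniform convergence of the partial sums of any enumeration. *)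
Definition sums_uniformly_on (C : set R) (J : set int) (a : int -> R -> R) :=
  {uniform C, (fun A t => psum J (a ^~ t) A) @ summability.totally -->
              (fun t => sum_over J (a ^~ t))}.

End series.

Section sampling.
Context {R : realType}.
Variables (I : set R) (J : nat -> set int) (nu : nat -> int -> R)
          (K : nat -> int -> R -> R).

Definition abs_sum (n : nat) (t : R) : \bar R :=
  (\esum_(k in J n) (`|K n k t|)%:E)%E.

Definition abs_tail (d : R) (n : nat) (t : R) : \bar R :=
  (\esum_(k in J n `&` [set k | (d <= `|nu n k - t|)%R])
     (`|K n k t|)%:E)%E.

Definition sampling_op (n : nat) (f : R -> R) (t : R) : R :=
  sum_over (J n) (fun k => f (nu n k) * K n k t).

(* Extended-real valued, so that it is not a junk value on unbounded [g]. *)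
Definition sup_norm (g : R -> R) : \bar R :=
  ereal_sup [set (`|g t|)%:E | t in I].

End sampling.

(* Main.v *)
(** Since the kernels sum to 1, [S_n f t - f t] is the sum of the terms
    [(f (nu n k) - f t) * K n k t].  The nodes within distance [d] of [t]
    contribute at most the oscillation of [f] there times [M0], by (3), and the
    remaining ones at most [2 * sup |f|] times the tail of (4). *)

Require Import Defs.
From HB Require Import structures.
From mathcomp Require Import all_boot all_order all_algebra finmap.
From mathcomp Require Import all_classical all_reals all_analysis.
From mathcomp.analysis.showcase Require summability.
From mathcomp Require Import ring lra.
Import Order.TTheory GRing.Theory Num.Theory.
Import numFieldNormedType.Exports.
Local Open Scope classical_set_scope.
Local Open Scope ring_scope.
#[local] Existing Instance summability.totally_filter.

Section psum.
Set Implicit Arguments.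
Unset Strict Implicit.
Context {R : realType}.
Implicit Types (J : set int) (a b : int -> R) (A B : {fset int}).

Lemma psumD J a b A : psum J (fun k => a k + b k) A = psum J a A + psum J b A.
Proof. by rewrite /psum big_split. Qed.

Lemma psumZ J c a A : psum J (fun k => c * a k) A = c * psum J a A.
Proof. by rewrite /psum mulr_sumr. Qed.

Lemma ler_psum J a b A : (forall k, J k -> a k <= b k) ->
  psum J a A <= psum J b A.
Proof. by move=> ab; apply: ler_sum => k; rewrite inE; exact: ab. Qed.

Lemma psum_sub J a A B : (forall k, J k -> 0 <= a k) -> (A `<=` B)%fset ->
  psum J a A <= psum J a B.
Proof.
move=> a0 AB; rewrite /psum.
(* [F] vanishes off [A], so its sum over [A] is also its sum over [B], where it can be compared term
   by term with the family cut down to [J]. *)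
pose F k := if (k \in J) && (k \in A) then a k else 0.
rewrite big_mkcond [leRHS]big_mkcond/=.
have -> : \sum_(k <- A) (if k \in J then a k else 0) = \sum_(k <- A) F k.
  by apply: eq_big_seq => k kA; rewrite /F kA andbT.
rewrite (big_fset_incl _ AB) => [|k _ kA]; last by rewrite /F (negbTE kA) andbF.
apply: ler_sum => k _; rewrite /F; case: (boolP (k \in J)) => //= kJ.
by case: ifP => // _; apply: a0; rewrite inE in kJ.
Qed.

(** Carries the bounds on [abs_sum] and [abs_tail] over to real partial sums: [\esum] is a supremum
    over finite subsets of [J], and [A] intersected with [J] is one of them. *)
Lemma psum_le_esum J a A : (forall k, J k -> 0 <= a k) ->
  ((psum J a A)%:E <= \esum_(k in J) (a k)%:E)%E.
Proof.
move=> a0; apply: esum_ge; exists ([set` A] `&` J).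
  by split; [exact/finite_setIl/finite_fset|exact: subIsetr].
rewrite (fsbigE [seq k <- A | k \in J]) ?filter_uniq ?fset_uniq//=.
- rewrite big_filter_cond -sumEFin big_seq_cond [leRHS]big_seq_cond.
  rewrite [leRHS](eq_bigl (fun k => (k \in A) && (k \in J))) ?lexx// => k.
  by rewrite in_setI mem_setE; case: (k \in A); case: (k \in J).
- by move=> k /=; rewrite mem_filter => /andP[/set_mem].
- by move=> k /= [kA kJ]; rewrite mem_filter kA andbT notin_setE.
Qed.

(** Monotone convergence along finite sets: once some [A] comes within [e] of the supremum, every
    larger set does too. *)
Lemma nneg_psum_cvg J a (M : R) : (forall k, J k -> 0 <= a k) ->
  (forall A, psum J a A <= M) -> cvg (psum J a @ summability.totally).
Proof.
move=> a0 aM; have hs : has_sup (range (psum J a)).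
  by split; [exists (psum J a fset0); exists fset0|exists M => _ [A _ <-]].
apply/cvg_ex; exists (sup (range (psum J a))); apply/cvgrPdist_le => e e0.
have [_ [A _ <-] eA] := sup_adherent e0 hs.
exists A => // B /= AB; rewrite ger0_norm ?subr_ge0.
  by have := psum_sub a0 AB; lra.
by apply: sup_upper_bound => //; exists B.
Qed.

(** Write [a] as [(|a| + a) - |a|], a difference of nonnegative families with partial sums at most
    [2 * M] and [M]. *)
Lemma abs_psum_cvg J a (M : R) : (forall A, psum J (fun k => `|a k|) A <= M) ->
  cvg (psum J a @ summability.totally).
Proof.
move=> aM.
have -> : psum J a = fun A =>
    psum J (fun k => `|a k| + a k) A - psum J (fun k => `|a k|) A.
  by apply/funext => A; rewrite psumD addrAC subrr add0r.
apply: is_cvgB; last by apply: nneg_psum_cvg aM.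
apply: (@nneg_psum_cvg _ _ (M + M)) => [k _|A].
  by rewrite -lerBlDr sub0r ler_normr lexx orbT.
rewrite psumD lerD// (le_trans _ (aM A))//; apply: ler_psum => k _.
exact: ler_norm.
Qed.

End psum.

Lemma nneg_cvge0 (R : realType) (u : (\bar R)^nat) :
  (forall n, 0 <= u n)%E ->
  (forall e : R, 0 < e -> \forall n \near \oo, (u n <= e%:E)%E) ->
  u @ \oo --> 0%E.
Proof.
move=> u0 ue; apply/fine_cvgP; split.
  near=> n; rewrite ge0_fin_numE; last exact: u0.
  have : (u n <= 1%:E)%E by near: n; exact: ue.
  by move/le_lt_trans; apply; rewrite ltry.
apply/cvgr0Pnorm_le => e e0; near=> n.
have une : (u n <= e%:E)%E by near: n; exact: ue.
rewrite /= ger0_norm ?fine_ge0// -lee_fin fineK// ge0_fin_numE//.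
by rewrite (le_lt_trans une)// ltry.
Unshelve. all: by end_near. Qed.

Lemma cvge0_lt (R : realType) (u : (\bar R)^nat) (e : R) :
  u @ \oo --> 0%E -> 0 < e -> \forall n \near \oo, (u n < e%:E)%E.
Proof.
move=> u0 e0; apply: (u0 [set y | (y < e%:E)%E]).
by apply: open_ereal_lt'; rewrite lte_fin.
Qed.

(** The estimate at a single [n] and [t]. Both claims follow from it; they differ only in whether
    [d] and the range of [n] may depend on [t]. *)
Lemma sampling_op_error (R : realType) (I : set R) (J : nat -> set int)
    (nu : nat -> int -> R) (K : nat -> int -> R -> R) (f : R -> R)
    (n : nat) (t e d B M eta : R) :
  I t -> (forall k, J n k -> I (nu n k)) -> sums_to (J n) (K n ^~ t) 1 ->
  0 <= e -> (forall s, I s -> `|f s| <= B) ->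
  (forall s, I s -> `|s - t| < d -> `|f s - f t| <= e) ->
  (abs_sum J K n t <= M%:E)%E -> (abs_tail J nu K d n t <= eta%:E)%E ->
  `|sampling_op J nu K n f t - f t| <= e * M + 2 * B * eta.
Proof.
move=> It nuI K1 e0 fB fe KM Keta.
have B0 : 0 <= B := le_trans (normr_ge0 _) (fB _ It).
have KMA A : psum (J n) (fun k => `|K n k t|) A <= M.
  by rewrite -lee_fin (le_trans _ KM)// psum_le_esum.
pose far := [set k | d <= `|nu n k - t|].
have KetaA A : psum (J n `&` far) (fun k => `|K n k t|) A <= eta.
  by rewrite -lee_fin (le_trans _ Keta)// psum_le_esum.
(* [sampling_op] is defined through [lim], which is informative only once the series is known to
   converge. *)
have fK_cvg : cvg (psum (J n) (fun k => f (nu n k) * K n k t)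
                   @ summability.totally).
  apply: (@abs_psum_cvg _ _ _ (B * M)) => A.
  rewrite (le_trans _ (ler_wpM2l B0 (KMA A)))// -psumZ ler_psum// => k Jk.
  by rewrite normrM ler_wpM2r ?fB//; exact: nuI.
(* As the kernels sum to 1, the error is a limit of finite sums, so it suffices to bound these for
   each [A]. *)
have dcvg : (psum (J n) (fun k => f (nu n k) * K n k t) A
    - f t * psum (J n) (K n ^~ t) A) @[A --> summability.totally] -->
    sampling_op J nu K n f t - f t.
  by apply: cvgB => //; rewrite -[X in _ --> X]mulr1;
    apply: cvgM => //; exact: cvg_cst.
apply: (cvgr_to_le (cvg_norm dcvg)); apply: nearW => A.
have -> : psum (J n) (fun k => f (nu n k) * K n k t) A
    - f t * psum (J n) (K n ^~ t) A
    = psum (J n) (fun k => (f (nu n k) - f t) * K n k t) A.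
  rewrite -mulNr -psumZ -psumD; congr (psum _ _ A).
  by apply/funext => k; rewrite mulrBl mulNr.
apply: (@le_trans _ _ (e * psum (J n) (fun k => `|K n k t|) A
  + 2 * B * psum (J n `&` far) (fun k => `|K n k t|) A)); last first.
  by rewrite lerD// ler_wpM2l// mulr_ge0.
(* The sum over far nodes becomes a sum over [J n] with zero terms at the near ones, which allows a
   termwise comparison. *)
rewrite -!psumZ {3}/psum.
under [X in _ + X]eq_bigl do rewrite in_setI.
rewrite big_mkcondr/= -[X in _ + X]/(psum (J n) _ A) -psumD.
apply: le_trans (ler_norm_sum _ _ _) _; apply: ler_psum => k Jk.
rewrite normrM; case: ifPn => kfar.
  rewrite -[leLHS]add0r lerD ?mulr_ge0// ler_wpM2r//.
  by rewrite (le_trans (ler_normB _ _))// mulr_natl mulr2n lerD// fB//; exact: nuI.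
rewrite addr0 ler_wpM2r// fe//; first exact: nuI.
by rewrite ltNge; apply: contra kfar => h; rewrite inE.
Qed.

Theorem theorem2p2 (R : realType) (I : set R) (J : nat -> set int)
    (nu : nat -> int -> R) (lam Lam : nat -> R) (K : nat -> int -> R -> R)
    (I_itv : is_interval I)
    (nu_in : forall n k, (0 < n)%N -> J n k -> I (nu n k))
    (lam_gt0 : forall n, (0 < n)%N -> 0 < lam n)
    (Lam_gt0 : forall n, (0 < n)%N -> 0 < Lam n)
    (nu_step : forall n k, (0 < n)%N -> J n k -> J n (k + 1) ->
       lam n < nu n (k + 1) - nu n k <= Lam n)
    (lam_cvg : lam n @[n --> \oo] --> (0 : R))
    (Lam_cvg : Lam n @[n --> \oo] --> (0 : R))
    (K_cont : forall n k, (0 < n)%N -> J n k -> {within I, continuous (K n k)})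
    (K_sum1 : forall n t, (0 < n)%N -> I t -> sums_to (J n) (K n ^~ t) 1)
    (K_unif : forall n (C : set R), (0 < n)%N -> compact C -> C `<=` I ->
       sums_uniformly_on C (J n) (fun k t => `|K n k t|))
    (K_bnd : exists M0 : R, forall n, (0 < n)%N ->
       (ereal_sup [set abs_sum J K n t | t in I] < M0%:E)%E)
    (K_tail : forall (d : R) t, 0 < d -> I t ->
       abs_tail J nu K d n t @[n --> \oo] --> 0%E)
    (f : R -> R) (f_bnd : [bounded f t | t in I]) :
  (forall t, I t -> f s @[s --> within I (nbhs t)] --> f t ->
     sampling_op J nu K n f t @[n --> \oo] --> f t)
  /\
  (unif_continuous (f : subspace I -> R) ->
   (forall d : R, 0 < d ->
      ereal_sup [set abs_tail J nu K d n t | t in I] @[n --> \oo] --> 0%E) ->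
   sup_norm I (sampling_op J nu K n f \- f) @[n --> \oo] --> 0%E).
Proof.
have [B B0 fB] : exists2 B : R, 0 < B & forall s, I s -> `|f s| <= B.
  by have [B B0 fB] := pinfty_ex_gt0 f_bnd; exists B.
have [M M0 KM] : exists2 M : R, 0 < M & forall n t, (0 < n)%N -> I t ->
    (abs_sum J K n t <= M%:E)%E.
  (* For empty [I] the given bound could be negative or zero; [|M0| + 1] is positive in every case,
     so that dividing by [M] is safe. *)
  have [M0 KM0] := K_bnd; exists (`|M0| + 1) => [|n t n0 It].
    by rewrite ltr_wpDl.
  apply: (@le_trans _ _ M0%:E); last by rewrite lee_fin ler_wpDr// ler_norm.
  by apply: le_trans (ltW (KM0 _ n0)); apply: ereal_sup_ubound; exists t.
(* The tolerances [e / 2 / M] and [e / 4 / B] make the near and far contributions [e / 2] each. *)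
have error n (t d e : R) : (0 < n)%N -> I t -> 0 < e ->
    (forall s, I s -> `|s - t| < d -> `|f s - f t| <= e / 2 / M) ->
    (abs_tail J nu K d n t <= (e / 4 / B)%:E)%E ->
    `|sampling_op J nu K n f t - f t| <= e.
  move=> n0 It e0 fe Ke.
  have -> : e = e / 2 / M * M + 2 * B * (e / 4 / B).
    by field; rewrite (gt_eqF B0) (gt_eqF M0).
  apply: (@sampling_op_error _ I _ _ _ _ _ _ _ d) => //.
  - by move=> k; exact: nu_in.
  - exact: K_sum1.
  - by rewrite !divr_ge0// ltW.
  - exact: KM.
split=> [t It ft|fu Ku].
  apply/cvgrPdist_le => e e0.
  have e'0 : 0 < e / 2 / M by rewrite !divr_gt0.
  (* Here [d] depends on [t], and so does the threshold for [n] obtained from [K_tail]. *)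
  have [d /= d0 fd] := (cvgrPdist_le _ _).1 ft _ e'0.
  near=> n; rewrite distrC; apply: (@error n t d) => //.
  - by near: n; exists 1%N.
  - move=> s Is st; rewrite distrC; apply: fd => //=.
    by rewrite /ball/= distrC.
  - by apply: ltW; near: n; apply: cvge0_lt; [exact: K_tail|rewrite !divr_gt0].
(* The supremum over an empty [I] would be [-oo], contradicting [Ku]. *)
have [t0 It0] : I !=set0.
  apply/set0P/negP => /eqP I0.
  suff : (-oo = 0 :> \bar R)%E by [].
  have := Ku 1 ltr01; rewrite (_ : (fun n => _) = cst -oo%E).
    by move=> K0; apply: cvg_unique K0 => //; exact: cvg_cst.
  by apply/funext => n; rewrite I0 image_set0 ereal_sup0.
apply: nneg_cvge0 => [n|e e0].
  (* The value at [t0] is a nonnegative member of the set, hence so is the supremum. *)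
  apply: le_ereal_sup_tmp; exists `|sampling_op J nu K n f t0 - f t0|%:E.
    by exists t0.
  by rewrite lee_fin.
have e'0 : 0 < e / 2 / M by rewrite !divr_gt0.
have [d d0 fd] : exists2 d : R, 0 < d &
    forall s t, I s -> I t -> `|s - t| < d -> `|f s - f t| <= e / 2 / M.
  have [E entE Esub] := fu _ (entourage_ball R (PosNum e'0)).
  move: entE; rewrite -(@entourage_ballE R) => -[d /= d0 dE].
  exists d => // s t Is It st.
  (* An entourage of the subspace [I] relates equal points, or two points of [I] related by an
     entourage of [R]; the second alternative applies. *)
  have /= := Esub (s, t) (or_intror (conj Is (conj It (dE (s, t) st)))).
  exact: ltW.
(* [n] is fixed before [t]: [d] is uniform, and the supremum in [Ku] bounds the tails at all [t] at
   once. *)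
near=> n; apply: ge_ereal_sup => _ [t It <-]; rewrite lee_fin/=.
apply: (@error n t d) => //.
- by near: n; exists 1%N.
- by move=> s Is; exact: fd.
- apply: (@le_trans _ _ (ereal_sup [set abs_tail J nu K d n t | t in I])).
    by apply: ereal_sup_ubound; exists t.
  by apply: ltW; near: n; apply: cvge0_lt; [exact: Ku|rewrite !divr_gt0].
Unshelve. all: by end_near. Qed.
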